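(* Let $x\in V$ be a solution of $$b_K(x,\varphi)=-\tfrac{1}{\sqrt{\alpha}}(u_d,I\varphi_1)_W\quad\text{for all }\varphi=(\varphi_1,\varphi_2)\in V,$$ and let $x_h\in V_h$ be its approximation given by $$b_K(x_h,\varphi_h)=-\tfrac{1}{\sqrt{\alpha}}(u_d,I\varphi_{h,1})_W\quad\text{for all }\varphi_h=(\varphi_{h,1},\varphi_{h,2})\in V_h.$$ Then $$d_{K,\alpha}(x,x_h)\le(\kappa_h\mu_h+1)\inf_{v_h\in V_h}d_{K,\alpha}(x,v_h),$$ where $$\kappa_h=\frac{1+2L}{1+L}\left(1+M\left(1+\frac{2M}{\sqrt{\alpha}}\right)\mu_h\right),\qquad L=\frac{M}{\sqrt{\alpha}},$$ and $\mu_h$ is the quasi-best-approximation constant of the constraint discretization.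
   Context: Let $Q, W, V_1, V_2$ be real Hilbert spaces with norms $\|\cdot\|_Q,\|\cdot\|_W,\|\cdot\|_1,\|\cdot\|_2$; $\langle\cdot,\cdot\rangle_i$ denotes the duality pairing of $V_i^*$ and $V_i$. Let $a:V_1\times V_2\to\mathbb{R}$ be a bounded bilinear form such that, for all $v_1\in V_1$, if $a(v_1,v_2)=0$ for all $v_2\in V_2$, then $v_1=0$, and $\inf_{\|v_2\|_2=1}\sup_{\|v_1\|_1=1}a(v_1,v_2)>0$. The norm of $V_2$ is (after replacing it, if necessary, by an equivalent one) $\|v_2\|_2=\sup_{\varphi_1\in V_1,\ \|\varphi_1\|_1=1}a(\varphi_1,v_2)$, so that the continuity and inf-sup constants of $a$ are both $1$. Let $C:Q\to V_2^*$ and $I:V_1\to W$ be bounded linear operators with operator norms $M_C$ and $M_I$, $C^*:V_2\to Q$ given by $(q,C^*v_2)_Q=\langle Cq,v_2\rangle_2$, and $M:=\max\{M_I,M_C\}$. Let $\alpha>0$, $u_d\in W$. Let $K\subset Q$ be nonempty, closed and convex, and let $\Pi_K:Q\to K$ be the metric projection onto $K$. Set $V:=V_1\times V_2$ with $\|v\|:=(\|v_1\|_1^2+\|v_2\|_2^2)^{1/2}$ and, for $v,w,\varphi\in V$, $$b_K(v,\varphi):=a(v_1,\varphi_2)+a(\varphi_1,v_2)-\big(\Pi_K(-\tfrac{1}{\sqrt{\alpha}}C^*v_2),C^*\varphi_2\big)_Q-\tfrac{1}{\sqrt{\alpha}}(Iv_1,I\varphi_1)_W,$$ $$\delta_{K,\alpha}(v,w)^2:=\alpha\big\|\Pi_K(-\tfrac{1}{\sqrt{\alpha}}C^*v_2)-\Pi_K(-\tfrac{1}{\sqrt{\alpha}}C^*w_2)\big\|_Q^2+\|I(v_1-w_1)\|_W^2,$$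 $$d_{K,\alpha}(v,w):=\|v-w\|+\frac{M}{\sqrt{\alpha}}\,\delta_{K,\alpha}(v,w).$$ Let $V_{h,i}\subset V_i$, $i=1,2$, be finite-dimensional subspaces such that the restriction of $a$ to $V_{h,1}\times V_{h,2}$ is nondegenerate (no nonzero element of either space is annihilated by the whole other space), and $V_h:=V_{h,1}\times V_{h,2}$. The generalized Ritz projection $R_{h,1}:V_1\to V_{h,1}$ is given by $a(R_{h,1}v_1,\varphi_{h,2})=a(v_1,\varphi_{h,2})$ for all $\varphi_{h,2}\in V_{h,2}$. The quasi-best-approximation constant $\mu_h$ of the constraint discretization is the smallest number $\mu_h\ge1$ such that $\|v_1-R_{h,1}v_1\|_1\le\mu_h\inf_{v_{h,1}\in V_{h,1}}\|v_1-v_{h,1}\|_1$ for all $v_1\in V_1$. *)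

(* Defs.v *)
From HB Require Import structures.
From mathcomp Require Export all_boot all_order all_algebra.
From mathcomp Require Export sesquilinear.
From mathcomp Require Export all_classical all_reals all_analysis.
Import Order.TTheory GRing.Theory Num.Theory.
Import numFieldNormedType.Exports.

Set Implicit Arguments.
Unset Strict Implicit.
Unset Printing Implicit Defensive.

Local Open Scope classical_set_scope.
Local Open Scope ring_scope.

HB.mixin Record CompleteNormedModule_isHilbert (R : realType) V
    & CompleteNormedModule R V := {
  inner : {dot V for (@idfun R)} ;
  inner_norm : forall v : V, inner v v = `|v| ^+ 2 }.

#[short(type="hilbertType")]
HB.structure Definition Hilbert (R : realType) :=
  {V of CompleteNormedModule R V & CompleteNormedModule_isHilbert R V}.

Definition is_dual (R : realType) (V : hilbertType R) : {pred V -> R^o} :=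
  fun f => `[< linear f /\ continuous f >].

Lemma is_dual_submod_closed (R : realType) (V : hilbertType R) :
  submod_closed (@is_dual R V).
Proof.
split=> [|k f g /asboolP[lf cf] /asboolP[lg cg]]; apply/asboolP; split.
- by move=> k u v /=; rewrite scaler0 addr0.
- by move=> v; exact: cst_continuous.
- move=> c u v /=.
  rewrite -[LHS]/(k *: f (c *: u + v) + g (c *: u + v)).
  rewrite -[RHS]/(c *: (k *: f u + g u) + (k *: f v + g v)).
  rewrite lf lg !scalerDr !scalerA (mulrC k c) -!addrA; congr (_ + _).
  by rewrite addrCA.
- by move=> v; apply: continuousD; [apply: continuousZl_tmp; exact: cf|exact: cg].
Qed.

HB.instance Definition _ (R : realType) (V : hilbertType R) :=
  GRing.isSubmodClosed.Build R (V -> R^o) (@is_dual R V)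
    (@is_dual_submod_closed R V).

Record dual (R : realType) (V : hilbertType R) := Dual {
  dual_val :> V -> R^o ;
  dual_prop : dual_val \in @is_dual R V }.

HB.instance Definition _ (R : realType) (V : hilbertType R) :=
  [isSub for @dual_val R V].
HB.instance Definition _ (R : realType) (V : hilbertType R) :=
  [Choice of dual V by <:].
HB.instance Definition _ (R : realType) (V : hilbertType R) :=
  [SubChoice_isSubLmodule of dual V by <:].

Definition unit_sphere (R : realType) (V : hilbertType R) : set V :=
  [set v | `|v| = 1].
Arguments unit_sphere {R} V.

(* The norm [nF] of the target is an argument because it is [Num.norm] or
   [dual_norm]. *)
Definition bounded_op (R : realType) (E : hilbertType R) (F : Type)
    (nF : F -> R) (f : E -> F) : Prop :=
  exists c : R, forall u, nF (f u) <= c * `|u|.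

(* The index set is the closed ball rather than the sphere, so that it is
   nonempty even when the space is trivial. *)
Definition opnorm (R : realType) (E : hilbertType R) (F : Type)
    (nF : F -> R) (f : E -> F) : R :=
  sup [set nF (f u) | u in [set u : E | `|u| <= 1]].

Definition dual_norm (R : realType) (V : hilbertType R) (f : dual V) : R :=
  opnorm Num.norm f.

Definition bounded_bilinear (R : realType) (V1 V2 : hilbertType R)
    (a : V1 -> V2 -> R) : Prop :=
  exists c : R, forall v1 v2, `|a v1 v2| <= c * `|v1| * `|v2|.

(* Extended-real valued, so that the infimum over an empty sphere is +oo. *)
Definition infsup (R : realType) (V1 V2 : hilbertType R)
    (a : V1 -> V2 -> R) : \bar R :=
  ereal_inf [set ereal_sup [set (a v1 v2)%:E | v1 in unit_sphere V1]
            | v2 in unit_sphere V2].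

Definition is_adjoint (R : realType) (Q V2 : hilbertType R)
    (C : Q -> dual V2) (Cs : V2 -> Q) : Prop :=
  forall q v2, inner q (Cs v2) = C q v2.

Definition is_metric_projection (R : realType) (Q : hilbertType R)
    (K : set Q) (P : Q -> Q) : Prop :=
  forall q, K (P q) /\ forall k, K k -> `|q - P q| <= `|q - k|.

Definition finite_dim_subspace (R : realType) (V : hilbertType R)
    (S : set V) : Prop :=
  exists (n : nat) (e : 'I_n -> V),
    S = [set \sum_(i < n) c i *: e i | c in [set: 'I_n -> R]].

Definition nondegenerate_on (R : realType) (V1 V2 : hilbertType R)
    (a : V1 -> V2 -> R) (S1 : set V1) (S2 : set V2) : Prop :=
  (forall v1, S1 v1 -> (forall v2, S2 v2 -> a v1 v2 = 0) -> v1 = 0) /\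
  (forall v2, S2 v2 -> (forall v1, S1 v1 -> a v1 v2 = 0) -> v2 = 0).

Definition is_ritz_projection (R : realType) (V1 V2 : hilbertType R)
    (a : V1 -> V2 -> R) (S1 : set V1) (S2 : set V2) (P : V1 -> V1) : Prop :=
  forall v1, S1 (P v1) /\ forall phi2, S2 phi2 -> a (P v1) phi2 = a v1 phi2.

Definition quasi_best_bounds (R : realType) (V1 : hilbertType R)
    (S1 : set V1) (P : V1 -> V1) : set R :=
  [set mu | 1 <= mu /\
    forall v1, `|v1 - P v1| <= mu * inf [set `|v1 - w1| | w1 in S1]].

Definition is_quasi_best_constant (R : realType) (V1 : hilbertType R)
    (S1 : set V1) (P : V1 -> V1) (mu : R) : Prop :=
  quasi_best_bounds S1 P mu /\ lbound (quasi_best_bounds S1 P) mu.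

(* The norm that MathComp-Analysis puts on [V1 * V2] is the maximum norm,
   hence this separate Hilbert product norm. *)
Definition prod_norm (R : realType) (V1 V2 : hilbertType R)
    (v : V1 * V2) : R :=
  Num.sqrt (`|v.1| ^+ 2 + `|v.2| ^+ 2).

Definition bform (R : realType) (Q W V1 V2 : hilbertType R)
    (a : V1 -> V2 -> R) (Cs : V2 -> Q) (I : V1 -> W) (alpha : R)
    (PK : Q -> Q) (v phi : V1 * V2) : R :=
  a v.1 phi.2 + a phi.1 v.2
  - inner (PK ((- (Num.sqrt alpha)^-1) *: Cs v.2)) (Cs phi.2)
  - (Num.sqrt alpha)^-1 * inner (I v.1) (I phi.1).

Definition delta (R : realType) (Q W V1 V2 : hilbertType R)
    (Cs : V2 -> Q) (I : V1 -> W) (alpha : R) (PK : Q -> Q)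
    (v w : V1 * V2) : R :=
  Num.sqrt
    (alpha * `|PK ((- (Num.sqrt alpha)^-1) *: Cs v.2)
               - PK ((- (Num.sqrt alpha)^-1) *: Cs w.2)| ^+ 2
     + `|I (v.1 - w.1)| ^+ 2).

Definition dist_K (R : realType) (Q W V1 V2 : hilbertType R)
    (Cs : V2 -> Q) (I : V1 -> W) (alpha M : R) (PK : Q -> Q)
    (v w : V1 * V2) : R :=
  prod_norm (v - w) + M / Num.sqrt alpha * delta Cs I alpha PK v w.

(* Main.v *)
(* Write [x] for the solution, [xh] for the discrete one, and fix [vh] in [Vh].
   With [D = d(x, vh)], continuity of [bform] in the metric [d] (constant 1)
   and Galerkin orthogonality bound the residual of [vh] on [Vh] by [D].
   Testing it with [(-u1, u2)], [u = vh - xh], cancels the bilinear form [a], and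
   firm nonexpansiveness of the projection onto [K] gives
   [delta(vh, xh)^2 <= sqrt alpha * D * |u|].  The discrete inf-sup constant
   of [a] is at least [1 / mu], because the Ritz projection has norm at most [mu] by
   Kato's identity [|P| = |Id - P|], hence [|u| <= mu * (D + L * delta(vh, xh))].
   Combining the two bounds by a weighted AM-GM inequality gives
   [d(vh, xh) <= kappa * mu * D]; the triangle inequality for [d] concludes. *)
From HB Require Import structures.
Require Import Defs.
From mathcomp Require Import ring lra.
Set Implicit Arguments.
Unset Strict Implicit.
Unset Printing Implicit Defensive.
Import Order.TTheory GRing.Theory Num.Theory.
Import numFieldNormedType.Exports.
Local Open Scope classical_set_scope.
Local Open Scope ring_scope.

(** * Inner product identities and Cauchy-Schwarz *)

Lemma innerC (R : realType) (V : hilbertType R) (u v : V) :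
  inner u v = inner v u.
Proof. by rewrite hermC expr0 mul1r. Qed.

Lemma innerZl (R : realType) (V : hilbertType R) (c : R) (u v : V) :
  inner (c *: u) v = c * inner u v.
Proof. by rewrite linearZl_LR. Qed.

Lemma innerZr (R : realType) (V : hilbertType R) (c : R) (u v : V) :
  inner u (c *: v) = c * inner u v.
Proof. by rewrite innerC innerZl innerC. Qed.

Lemma sqr_normD (R : realType) (V : hilbertType R) (u v : V) :
  `|u + v| ^+ 2 = `|u| ^+ 2 + 2 * inner u v + `|v| ^+ 2.
Proof.
rewrite -!inner_norm linearDl !linearDr /= (innerC v u).
by ring.
Qed.

Lemma inner_le (R : realType) (V : hilbertType R) (u v : V) :
  inner u v <= `|u| * `|v|.
Proof.
have h : `|u + v| ^+ 2 <= (`|u| + `|v|) ^+ 2.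
  by rewrite ler_sqr ?nnegrE ?addr_ge0// ler_normD.
move: h; rewrite sqr_normD; nra.
Qed.

Lemma inner_abs_le (R : realType) (V : hilbertType R) (u v : V) :
  `|inner u v| <= `|u| * `|v|.
Proof.
rewrite ler_norml inner_le andbT lerNl -linearNl /=.
by rewrite (le_trans (inner_le _ _))// normrN.
Qed.

(** * Metric projection onto a convex set *)

Lemma metric_projection_variational (R : realType) (Q : hilbertType R)
    (K : set Q) (P : Q -> Q) (q k : Q) :
  convex_set K -> is_metric_projection K P -> K k ->
  inner (q - P q) (k - P q) <= 0.
Proof.
move=> Kc KP Kk; have [KPq Pmin] := KP q.
rewrite leNgt; apply/negP; set X := inner _ _ => X0.
have Y0 : 0 <= `|k - P q| ^+ 2 by rewrite exprn_ge0.
have XY0 : 0 < X + `|k - P q| ^+ 2 by rewrite ltr_pwDl.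
(* Minimality of [P q] along the segment towards [k] gives [2 * X <= t * Y] with [Y = |k - P q|^2].
   This [t] lies in []0, 1]] and satisfies [t * Y = X - t * X < X], a contradiction. *)
pose t := X / (X + `|k - P q| ^+ 2).
have t0 : 0 < t by rewrite divr_gt0.
have t1 : t <= 1 by rewrite ler_pdivrMr// mul1r lerDl.
have Kt : K (P q + t *: (k - P q)).
  have -> : P q + t *: (k - P q) = t *: k + (1 - t) *: P q.
    by rewrite scalerBr scalerBl scale1r addrCA.
  by have := Kc k (P q) (Itv01 (ltW t0) t1); rewrite !inE; apply.
have := Pmin _ Kt; rewrite opprD addrA.
rewrite -(@ler_sqr R) ?nnegrE// (sqr_normD (q - P q)) linearNr /= innerZr -/X.
rewrite normrN normrZ exprMn real_normK ?num_real//.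
have tE : t * (X + `|k - P q| ^+ 2) = X by rewrite divfK// gt_eqF.
nra.
Qed.

(** Sum of the variational inequalities at [p] and at [q], each tested with the other projection. *)
Lemma metric_projection_firmly_nonexpansive (R : realType) (Q : hilbertType R)
    (K : set Q) (P : Q -> Q) (p q : Q) :
  convex_set K -> is_metric_projection K P ->
  `|P p - P q| ^+ 2 <= inner (P p - P q) (p - q).
Proof.
move=> Kc KP.
have hp := metric_projection_variational p Kc KP (KP q).1.
have hq := metric_projection_variational q Kc KP (KP p).1.
rewrite -inner_norm; move: hp hq.
rewrite !(linearBl, linearBr) /= (innerC p (P p)) (innerC p (P q)).
rewrite (innerC q (P p)) (innerC q (P q)) (innerC (P q) (P p)).
lra.
Qed.

(** * Operator norms and dual norms *)

Lemma opnorm_ge_unit_ball (R : realType) (E : hilbertType R) (F : Type)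
    (nF : F -> R) (f : E -> F) (u : E) :
  bounded_op nF f -> `|u| <= 1 -> nF (f u) <= opnorm nF f.
Proof.
move=> [c fc] u1; apply: ub_le_sup; last by exists u.
exists `|c| => _ [v /= v1 <-]; rewrite (le_trans (fc v))//.
by rewrite (le_trans (ler_norm _))// normrM normr_id ler_piMr.
Qed.

(** Rescaling to the unit ball needs only an inequality for scalar multiples, so [nF] can be
    [Num.norm] as well as [dual_norm]. *)
Lemma opnorm_le_mul (R : realType) (E : hilbertType R) (F : lmodType R)
    (nF : F -> R) (f : {linear E -> F}) (u : E) :
  (forall (c : R) w, nF (c *: w) <= `|c| * nF w) -> bounded_op nF f ->
  nF (f u) <= opnorm nF f * `|u|.
Proof.
move=> nFZ fb; have [->|u0] := eqVneq u 0.
  by rewrite linear0 -(scale0r 0) (le_trans (nFZ _ _))// !normr0 mul0r mulr0.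
have nu : `|u| != 0 by rewrite normr_eq0.
have -> : f u = `|u| *: f (`|u|^-1 *: u).
  by rewrite -linearZ /= scalerA divff// scale1r.
rewrite (le_trans (nFZ _ _))// normr_id mulrC ler_wpM2r//.
apply: opnorm_ge_unit_ball => //.
by rewrite normrZ normfV normr_id mulVf.
Qed.

Lemma opnorm_ge0 (R : realType) (E : hilbertType R) (F : Type)
    (nF : F -> R) (f : E -> F) :
  (forall w, 0 <= nF w) -> bounded_op nF f -> 0 <= opnorm nF f.
Proof.
move=> nF0 fb; apply: le_trans (nF0 (f 0)) _.
by apply: opnorm_ge_unit_ball; rewrite ?normr0.
Qed.

Lemma dual_linear (R : realType) (V : hilbertType R) (f : dual V) :
  linear f.
Proof. by have /asboolP[] := dual_prop f. Qed.

Definition dual_linear_map (R : realType) (V : hilbertType R) (f : dual V) :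
    {linear V -> R^o} :=
  HB.pack (dual_val f) (GRing.isLinear.Build R V R^o _ f (dual_linear f)).

Lemma dual_bounded (R : realType) (V : hilbertType R) (f : dual V) :
  bounded_op (@Num.norm R R) f.
Proof.
have /asboolP[_ cf] := dual_prop f.
have /linear_boundedP /pinfty_ex_gt0[r _ rP] :
  bounded_near (dual_linear_map f) (nbhs 0) by exact/linear_bounded_continuous.
by exists r.
Qed.

Lemma dual_norm_le_mul (R : realType) (V : hilbertType R) (f : dual V) (v : V) :
  `|f v| <= dual_norm f * `|v|.
Proof.
apply: (@opnorm_le_mul _ _ R^o Num.norm (dual_linear_map f) v).
  by move=> c w; rewrite normrZ.
exact: dual_bounded.
Qed.

Lemma dual_norm_ge0 (R : realType) (V : hilbertType R) (f : dual V) :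
  0 <= dual_norm f.
Proof. by apply: opnorm_ge0 => //; exact: dual_bounded. Qed.

Lemma dual_normZ_le (R : realType) (V : hilbertType R) (c : R) (f : dual V) :
  dual_norm (c *: f) <= `|c| * dual_norm f.
Proof.
apply: ge_sup => [|_ [v /= v1 <-]].
  by exists `|(c *: f) 0|; exists 0; rewrite //= normr0.
rewrite [leLHS](_ : _ = `|c * f v|)// normrM ler_wpM2l//.
rewrite (le_trans (dual_norm_le_mul f v))//.
by rewrite ler_piMr// dual_norm_ge0.
Qed.

(** * Matrix kernels and Kato's identity *)

Lemma submx_right_kernel (F : fieldType) (n m p : nat) (A : 'M[F]_(m, n))
    (B : 'M[F]_(p, n)) :
  (forall y : 'cV[F]_n, A *m y = 0 -> B *m y = 0) -> (B <= A)%MS.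
Proof.
move=> h; rewrite submxE; apply/eqP/matrixP => i j.
(* The columns of [cokermx A] lie in the right kernel of [A], hence in that of [B]. *)
have : B *m (cokermx A *m delta_mx j (0 : 'I_1)) = 0.
  by apply: h; rewrite mulmxA mulmx_coker mul0mx.
by rewrite mulmxA -colE => /matrixP/(_ i 0); rewrite !mxE.
Qed.

(** The two factors are inverse to each other, so the inner product is unchanged while the two
    lengths are exchanged. *)
Lemma swap_lengths_norm (R : realType) (V : hilbertType R) (y z : V) :
  y != 0 -> z != 0 ->
  `|(`|z| / `|y|) *: y + (`|y| / `|z|) *: z| = `|y + z|.
Proof.
rewrite -(normr_eq0 y) -(normr_eq0 z) => ny nz; apply/eqP.
rewrite -(@eqrXn2 _ 2)// !sqr_normD.
rewrite innerZl innerZr [`|_ *: y|]normrZ [`|_ *: z|]normrZ.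
have -> : `| `|z| / `|y| | = `|z| / `|y| by rewrite ger0_norm// divr_ge0.
have -> : `| `|y| / `|z| | = `|y| / `|z| by rewrite ger0_norm// divr_ge0.
rewrite !divfK//.
by apply/eqP; field; rewrite ny nz.
Qed.

(* Kato's identity [|Id - P| = |P|] for idempotents of a Hilbert space:
   swapping the lengths of the components [P v] and [v - P v] keeps the norm
   of the sum. *)
Lemma idempotent_norm_le (R : realType) (V : hilbertType R) (P : V -> V)
    (mu : R) (v : V) :
  1 <= mu ->
  (forall (b c : R), P (b *: P v + c *: (v - P v)) = b *: P v) ->
  (forall w, `|w - P w| <= mu * `|w|) -> `|P v| <= mu * `|v|.
Proof.
move=> mu1 PP Pmu.
have [y0|y0] := eqVneq (P v) 0.
  by rewrite y0 normr0 mulr_ge0// (le_trans ler01).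
have [z0|z0] := eqVneq (v - P v) 0.
  by rewrite -(subr0_eq z0) ler_peMl.
have ny : `|P v| != 0 by rewrite normr_eq0.
have nz : `|v - P v| != 0 by rewrite normr_eq0.
pose y := P v; pose z := v - y.
pose w := (`|z| / `|y|) *: y + (`|y| / `|z|) *: z.
have wv : `|w| = `|v|.
  by rewrite /w swap_lengths_norm//; congr `|_|; rewrite addrC subrK.
(* [w - P w] is the rescaled [z], of norm [|P v|]; the bound on [Id - P] at [w] is thus the bound on
   [P] at [v]. *)
have := Pmu w; rewrite wv /w PP addrAC subrr add0r.
by rewrite normrZ normf_div !normr_id divfK.
Qed.

(** * Closure properties of finite-dimensional subspaces *)

Lemma finite_dim_subspace_sum (R : realType) (V : hilbertType R) (S : set V)
    (u v : V) (c d : R) :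
  finite_dim_subspace S -> S u -> S v -> S (c *: u + d *: v).
Proof.
move=> [n [e ->]] [f _ <-] [g _ <-]; exists (fun i => c * f i + d * g i) => //.
rewrite !scaler_sumr -big_split; apply: eq_bigr => i _.
by rewrite scalerDl !scalerA.
Qed.

Lemma finite_dim_subspace0 (R : realType) (V : hilbertType R) (S : set V) :
  finite_dim_subspace S -> S 0.
Proof.
move=> [n [e ->]]; exists (fun=> 0) => //.
by rewrite big1// => i _; rewrite scale0r.
Qed.

Lemma finite_dim_subspaceB (R : realType) (V : hilbertType R) (S : set V)
    (u v : V) :
  finite_dim_subspace S -> S u -> S v -> S (u - v).
Proof.
move=> Sf Su Sv; have := finite_dim_subspace_sum 1 (-1) Sf Su Sv.
by rewrite scale1r scaleN1r.
Qed.

Lemma finite_dim_subspaceZ (R : realType) (V : hilbertType R) (S : set V)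
    (u : V) (c : R) :
  finite_dim_subspace S -> S u -> S (c *: u).
Proof.
move=> Sf Su; have := finite_dim_subspace_sum c 0 Sf Su Su.
by rewrite scale0r addr0.
Qed.

(** * The norm of [V2] as a supremum of [a] *)

Lemma bilinear_le_norm (R : realType) (V1 V2 : hilbertType R)
    (a : {bilinear V1 -> V2 -> R | *%R & *%R}) (v1 : V1) (v2 : V2) :
  bounded_bilinear a ->
  (forall v2 : V2, `|v2| = sup [set a phi1 v2 | phi1 in unit_sphere V1]) ->
  a v1 v2 <= `|v1| * `|v2|.
Proof.
move=> [c ac] norm2E; have [->|v10] := eqVneq v1 0.
  by rewrite linear0l normr0 mul0r.
have nv : `|v1| != 0 by rewrite normr_eq0.
have -> : a v1 v2 = `|v1| * a (`|v1|^-1 *: v1) v2.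
  by rewrite -linearZl_LR/= scalerA divff// scale1r.
rewrite ler_wpM2l// norm2E; apply: ub_le_sup.
  exists (c * `|v2|) => _ [phi /= phi1 <-].
  by rewrite (le_trans (ler_norm _))// (le_trans (ac _ _))// phi1 mulr1.
by exists (`|v1|^-1 *: v1); rewrite // /unit_sphere /= normrZ normfV normr_id
  mulVf.
Qed.

(** The condition [0 <= c] covers a trivial [V1]: its unit sphere is empty and [sup set0] is 0. *)
Lemma norm_le_of_sphere (R : realType) (V1 V2 : hilbertType R)
    (a : V1 -> V2 -> R) (v2 : V2) (c : R) :
  `|v2| = sup [set a phi1 v2 | phi1 in unit_sphere V1] -> 0 <= c ->
  (forall phi1, `|phi1| = 1 -> a phi1 v2 <= c) -> `|v2| <= c.
Proof.
move=> -> c0 ac; set A := [set _ | _ in _].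
have [->|/set0P A0] := eqVneq A set0; first by rewrite sup0.
by apply: ge_sup => // _ [phi /= phi1 <-]; exact: ac.
Qed.

(** * Discrete Riesz representation and the Ritz projection *)

Lemma discrete_riesz (R : realType) (V1 V2 : hilbertType R)
    (a : {bilinear V1 -> V2 -> R | *%R & *%R}) (S1 : set V1) (S2 : set V2)
    (u1 : V1) :
  finite_dim_subspace S1 -> finite_dim_subspace S2 ->
  nondegenerate_on a S1 S2 ->
  exists2 v2, S2 v2 & forall phi1, S1 phi1 -> a phi1 v2 = inner phi1 u1.
Proof.
move=> [m [e S1E]] [n [f S2E]] [nd _].
pose A := \matrix_(j < n, i < m) a (e i) (f j).
pose B := \row_(i < m) inner (e i) u1.
(* [D] will be the coordinates of [v2]. The generators [e] need not be independent: [A *m y = 0]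
   gives only that the combination with coefficients [y] vanishes, which is enough for
   [B *m y = 0]. *)
have /submxP[D BE] : (B <= A)%MS.
  apply: submx_right_kernel => y Ay.
  have y0 : \sum_i y i 0 *: e i = 0.
    apply: nd; first by rewrite S1E; exists (fun i => y i 0).
    move=> v; rewrite S2E => -[c _ <-]; rewrite linear_sumr big1// => j _.
    rewrite linearZr_LR linear_sumlz/=.
    have /matrixP/(_ j 0) := Ay; rewrite !mxE => Ayj.
    rewrite -[RHS](mulr0 (c j)) -[in RHS]Ayj; congr (_ * _).
    by apply: eq_bigr => i _; rewrite linearZl_LR mxE mulrC.
  apply/matrixP => i j; rewrite !ord1 !mxE.
  transitivity (inner (\sum_i y i 0 *: e i) u1).
    rewrite linear_sumlz; apply: eq_bigr => k _.
    by rewrite mxE linearZl_LR mulrC.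
  by rewrite y0 linear0l.
exists (\sum_j D 0 j *: f j); first by rewrite S2E; exists (fun j => D 0 j).
move=> phi; rewrite S1E => -[c _ <-].
rewrite !linear_sumlz; apply: eq_bigr => i _.
rewrite !linearZl_LR /=; congr (_ * _).
have /rowP/(_ i) := BE; rewrite !mxE => ->.
rewrite linear_sumr; apply: eq_bigr => j _.
by rewrite linearZr_LR /= mxE.
Qed.

Lemma ritz_unique (R : realType) (V1 V2 : hilbertType R)
    (a : {bilinear V1 -> V2 -> R | *%R & *%R}) (S1 : set V1) (S2 : set V2)
    (P : V1 -> V1) (v w : V1) :
  finite_dim_subspace S1 -> nondegenerate_on a S1 S2 ->
  is_ritz_projection a S1 S2 P -> S1 w ->
  (forall phi2, S2 phi2 -> a w phi2 = a v phi2) -> P v = w.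
Proof.
move=> S1f [nd _] PP Sw aw; have [SPv aPv] := PP v.
apply/eqP; rewrite -subr_eq0; apply/eqP/nd => [|phi Sphi].
  exact: finite_dim_subspaceB.
by rewrite linearBl /= aPv// aw// subrr.
Qed.

(** Comparing with 0 in the best approximation bounds [Id - P] by [mu]; Kato's identity carries this
    over to [P], whose idempotency comes from [ritz_unique]. *)
Lemma ritz_norm_le (R : realType) (V1 V2 : hilbertType R)
    (a : {bilinear V1 -> V2 -> R | *%R & *%R}) (S1 : set V1) (S2 : set V2)
    (P : V1 -> V1) (mu : R) (v : V1) :
  finite_dim_subspace S1 -> nondegenerate_on a S1 S2 ->
  is_ritz_projection a S1 S2 P -> quasi_best_bounds S1 P mu ->
  `|P v| <= mu * `|v|.
Proof.
move=> S1f nd PP [mu1 muP]; apply: idempotent_norm_le => // [b c|w].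
  apply: (ritz_unique S1f nd PP).
    by apply: finite_dim_subspaceZ => //; case: (PP v).
  move=> phi Sphi; have [_ aPv] := PP v.
  rewrite [in RHS]linearDl !linearZl_LR /= linearBl /= aPv//.
  by rewrite subrr mulr0 addr0.
rewrite (le_trans (muP w))// ler_wpM2l// ?(le_trans ler01)//.
apply: ge_inf; first by exists 0 => _ [z _ <-].
by exists 0; [exact: finite_dim_subspace0|rewrite subr0].
Qed.

(** * Euclidean norm of the plane, the common form of [prod_norm] and [delta] *)

Definition hypot (R : realType) (a b : R) : R := Num.sqrt (a ^+ 2 + b ^+ 2).

Lemma hypot_ge0 (R : realType) (a b : R) : 0 <= hypot a b.
Proof. exact: sqrtr_ge0. Qed.

Lemma sqr_hypot (R : realType) (a b : R) : hypot a b ^+ 2 = a ^+ 2 + b ^+ 2.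
Proof. by rewrite sqr_sqrtr// addr_ge0// sqr_ge0. Qed.

(** Lagrange's identity: the squares of the two sides differ by [(a * d - b * c)^2]. *)
Lemma hypot_cauchy (R : realType) (a b c d : R) :
  a * c + b * d <= hypot a b * hypot c d.
Proof.
rewrite /hypot -sqrtrM ?addr_ge0 ?sqr_ge0//.
apply: le_trans (ler_norm _) _; rewrite -sqrtr_sqr ler_wsqrtr//.
have := sqr_ge0 (a * d - b * c); nra.
Qed.

Lemma hypot_triangle (R : realType) (a b c d p q : R) :
  0 <= p <= a + c -> 0 <= q <= b + d -> hypot p q <= hypot a b + hypot c d.
Proof.
move=> /andP[p0 pac] /andP[q0 qbd].
rewrite -(@ler_sqr R) ?nnegrE ?addr_ge0 ?hypot_ge0// sqrrD !sqr_hypot.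
have := hypot_cauchy a b c d; nra.
Qed.

Lemma hypot_le_scaled (R : realType) (a b p q mu : R) :
  0 <= mu -> 0 <= p <= mu * a -> 0 <= q <= mu * b ->
  hypot p q <= mu * hypot a b.
Proof.
move=> mu0 /andP[p0 pa] /andP[q0 qb].
rewrite -(@ler_sqr R) ?nnegrE ?mulr_ge0 ?hypot_ge0// exprMn !sqr_hypot mulrDr.
by rewrite -!exprMn lerD// ler_sqr ?nnegrE ?(le_trans p0 pa) ?(le_trans q0 qb).
Qed.

Lemma hypotC (R : realType) (a b : R) : hypot a b = hypot b a.
Proof. by rewrite /hypot addrC. Qed.

Lemma prod_normE (R : realType) (V1 V2 : hilbertType R) (v : V1 * V2) :
  prod_norm v = hypot `|v.1| `|v.2|.
Proof. by []. Qed.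

(** * Discrete stability and the constant [kappa] *)

Lemma discrete_stability (R : realType) (V1 V2 : hilbertType R)
    (a : {bilinear V1 -> V2 -> R | *%R & *%R}) (S1 : set V1) (S2 : set V2)
    (P : V1 -> V1) (mu c : R) (u : V1 * V2) :
  (forall v2 : V2, `|v2| = sup [set a phi1 v2 | phi1 in unit_sphere V1]) ->
  finite_dim_subspace S1 -> finite_dim_subspace S2 ->
  nondegenerate_on a S1 S2 -> is_ritz_projection a S1 S2 P ->
  quasi_best_bounds S1 P mu -> (S1 `*` S2) u -> 0 <= c ->
  (forall phi, (S1 `*` S2) phi ->
     a u.1 phi.2 + a phi.1 u.2 <= c * prod_norm phi) ->
  prod_norm u <= mu * c.
Proof.
move=> norm2E S1f S2f nd PP muP [Su1 Su2] c0 uc.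
have [mu1 _] := muP; have mu0 : 0 <= mu := le_trans ler01 mu1.
have Pmu := ritz_norm_le _ S1f nd PP muP.
(* [r] is the second component of the test function: [a u.1 r = |u.1|^2]. Its norm is controlled by
   replacing [phi] with [P phi] in the supremum. *)
have [r Sr rP] := discrete_riesz u.1 S1f S2f nd.
have r_le : `|r| <= mu * `|u.1|.
  apply: (norm_le_of_sphere (norm2E r)); rewrite ?mulr_ge0// => phi phi1.
  have [SP <-//] := PP phi; rewrite rP// (le_trans (inner_le _ _))//.
  by rewrite ler_wpM2r// (le_trans (Pmu phi))// phi1 mulr1.
(* The first component [psi] stays free because the supremum giving [|u.2|] need not be attained. *)
have test psi : S1 psi -> `|psi| <= mu * `|u.2| ->
    `|u.1| ^+ 2 + a psi u.2 <= c * (mu * prod_norm u).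
  move=> Spsi psi_le; rewrite -inner_norm -rP//.
  apply: le_trans (uc (psi, r) _) _ => //; rewrite ler_wpM2l// !prod_normE /=.
  by rewrite (hypotC `|u.1|) hypot_le_scaled// normr_ge0.
have N0 : 0 <= prod_norm u := hypot_ge0 _ _.
suff : prod_norm u ^+ 2 <= prod_norm u * (mu * c).
  rewrite expr2; move: N0; rewrite le_eqVlt => /predU1P[<- _|N0].
    by rewrite mulr_ge0.
  by rewrite ler_pM2l.
have slack : 0 <= c * (mu * prod_norm u) - `|u.1| ^+ 2.
  have := test 0 (finite_dim_subspace0 S1f).
  by rewrite linear0l addr0 subr_ge0 normr0 mulr_ge0//; apply.
(* The scaled vector has norm [|u.2|^2], so the supremum over [psi = |u.2| *: P phi] gives the
   missing square; [P phi] may replace [phi] because [u.2] is discrete. *)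
have : `| `|u.2| *: u.2 | <= c * (mu * prod_norm u) - `|u.1| ^+ 2.
  apply: (norm_le_of_sphere (norm2E _) slack) => phi phi1.
  have [SP aP] := PP phi.
  rewrite linearZr_LR -linearZl_LR /= lerBrDl.
  have -> : a (`|u.2| *: phi) u.2 = a (`|u.2| *: P phi) u.2.
    by rewrite !linearZl_LR /= aP.
  apply: test; first exact: finite_dim_subspaceZ.
  rewrite normrZ normr_id mulrC ler_wpM2r//.
  by rewrite (le_trans (Pmu phi))// phi1 mulr1.
rewrite normrZ normr_id -expr2 lerBrDl prod_normE sqr_hypot -prod_normE.
by rewrite mulrA [c * _]mulrC [_ * prod_norm u]mulrC.
Qed.

(* With [N = |u|] and [y = L * delta]: the weighted AM-GM step is
   [k * y <= L * N + k^2 * M * D / 4] for [k = (2 + 3 * L) * mu]. *)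
Lemma kappa_bound (R : realType) (M L D N y mu : R) :
  0 <= M -> 0 <= L -> 0 <= D -> 0 <= N -> 0 <= y -> 1 <= mu ->
  N <= mu * (D + y) -> y ^+ 2 <= M * L * D * N ->
  N + y <= (1 + 2 * L) / (1 + L) * (1 + M * (1 + 2 * L) * mu) * mu * D.
Proof.
move=> M0 L0 D0 N0 y0 mu1 Nle yle.
have L1 : 0 < 1 + L by rewrite ltr_pwDl.
have mu0 : 0 <= mu := le_trans ler01 mu1.
(* After multiplication by [1 + L], write [(1 + L) * N] as [(1 + 2 * L) * N - L * N]. Then [y]
   enters with the factor [(1 + 2 * L) * mu + (1 + L) * mu = k], and [- L * N] absorbs the AM-GM
   term. The final constant arises from [k / 2 <= (1 + 2 * L) * mu]. *)
have [k kE] : {k | k = (2 + 3 * L) * mu} by eexists.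
have amgm : k * y <= L * N + k ^+ 2 * M * D / 4.
  have k0 : 0 <= k by rewrite kE mulr_ge0//; lra.
  have MD4 : 0 <= k ^+ 2 * M * D / 4 by rewrite divr_ge0// !mulr_ge0.
  rewrite -(@ler_sqr R) ?nnegrE ?mulr_ge0 ?addr_ge0 ?mulr_ge0//.
  have kk : k ^+ 2 * y ^+ 2 <= k ^+ 2 * (M * L * D * N).
    by rewrite ler_wpM2l ?sqr_ge0.
  have := sqr_ge0 (L * N - k ^+ 2 * M * D / 4); lra.
have kle : k ^+ 2 / 4 <= ((1 + 2 * L) * mu) ^+ 2.
  rewrite kE !exprMn mulrAC ler_wpM2r ?sqr_ge0//; nra.
have kleMD : k ^+ 2 * M * D / 4 <= ((1 + 2 * L) * mu) ^+ 2 * (M * D).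
  by rewrite (_ : _ / 4 = k ^+ 2 / 4 * (M * D)) ?ler_wpM2r ?mulr_ge0//; ring.
have -> : (1 + 2 * L) / (1 + L) * (1 + M * (1 + 2 * L) * mu) * mu * D
  = ((1 + 2 * L) * mu * D + ((1 + 2 * L) * mu) ^+ 2 * (M * D)) / (1 + L).
  by field; rewrite gt_eqF.
rewrite ler_pdivlMr//.
have h1 : (1 + 2 * L) * N <= (1 + 2 * L) * (mu * (D + y)).
  by rewrite ler_wpM2l// addr_ge0// mulr_ge0.
have h2 : (1 + L) * y <= (1 + L) * (mu * y).
  by rewrite ler_wpM2l ?(ltW L1)// ler_peMl.
rewrite kE in amgm kleMD.
lra.
Qed.

(** * The adjoint operator *)

Lemma adjointB (R : realType) (Q V2 : hilbertType R)
    (C : Q -> dual V2) (Cs : V2 -> Q) (v w : V2) :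
  is_adjoint C Cs -> Cs (v - w) = Cs v - Cs w.
Proof.
(* [Cs] is a bare function; its additivity follows by pairing the defect [d] with itself. *)
move=> CsP; apply/eqP; rewrite -subr_eq0 -normr_eq0 -sqrf_eq0 -inner_norm.
set d := _ - _; rewrite {2}/d !linearBr /= !CsP.
have -> : C d (v - w) = C d v - C d w.
  exact: (linearB (dual_linear_map (C d))).
by rewrite subrr.
Qed.

Lemma adjoint_le (R : realType) (Q V2 : hilbertType R)
    (C : {linear Q -> dual V2}) (Cs : V2 -> Q) (q : Q) (v : V2) :
  bounded_op (@dual_norm R V2) C -> is_adjoint C Cs ->
  `|inner q (Cs v)| <= opnorm (@dual_norm R V2) C * `|q| * `|v|.
Proof.
move=> Cb CsP; rewrite CsP (le_trans (dual_norm_le_mul _ _))// ler_wpM2r//.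
by apply: opnorm_le_mul => // c w; exact: dual_normZ_le.
Qed.

(** * Metric, continuity and monotonicity estimates for [bform] *)

Section optimality_system.
Context (R : realType) (Q W V1 V2 : hilbertType R)
  (a : {bilinear V1 -> V2 -> R | *%R & *%R}) (I : {linear V1 -> W})
  (Cs : V2 -> Q) (alpha M : R) (PK : Q -> Q).

Let s := (Num.sqrt alpha)^-1.
Let proj (v : V1 * V2) := PK (- s *: Cs v.2).

Lemma bformB (v w phi : V1 * V2) :
  bform a Cs I alpha PK v phi - bform a Cs I alpha PK w phi
  = a (v - w).1 phi.2 + a phi.1 (v - w).2
    - inner (proj v - proj w) (Cs phi.2) - s * inner (I (v - w).1) (I phi.1).
Proof.
rewrite /bform /= [I (_ - _)]linearB !linearBl !linearBr /= -/s /proj; ring.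
Qed.

Context (alpha_gt0 : 0 < alpha).

Lemma deltaE (v w : V1 * V2) :
  delta Cs I alpha PK v w
  = hypot (Num.sqrt alpha * `|proj v - proj w|) `|I (v - w).1|.
Proof. by rewrite /hypot exprMn sqr_sqrtr ?ltW. Qed.

Lemma delta_ge0 (v w : V1 * V2) : 0 <= delta Cs I alpha PK v w.
Proof. exact: sqrtr_ge0. Qed.

Lemma dist_K_ge0 (v w : V1 * V2) : 0 <= M -> 0 <= dist_K Cs I alpha M PK v w.
Proof.
move=> M0; rewrite addr_ge0 ?sqrtr_ge0//.
by rewrite mulr_ge0 ?delta_ge0// divr_ge0 ?sqrtr_ge0.
Qed.

Lemma dist_KC (v w : V1 * V2) :
  dist_K Cs I alpha M PK v w = dist_K Cs I alpha M PK w v.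
Proof.
rewrite /dist_K !deltaE !prod_normE /= ![I (_ - _)]linearB.
by rewrite -!(distrC (proj w)) !(distrC w.1) (distrC w.2) (distrC (I w.1)).
Qed.

Lemma dist_K_triangle (v w z : V1 * V2) : 0 <= M ->
  dist_K Cs I alpha M PK v z
  <= dist_K Cs I alpha M PK v w + dist_K Cs I alpha M PK w z.
Proof.
move=> M0; rewrite /dist_K addrACA -mulrDr lerD//.
  rewrite !prod_normE; apply: hypot_triangle; rewrite normr_ge0 /=;
  by rewrite -[leLHS]/(`|_ - _|) ler_distD.
rewrite ler_wpM2l ?divr_ge0 ?sqrtr_ge0// !deltaE.
apply: hypot_triangle.
  by rewrite mulr_ge0 ?sqrtr_ge0// -mulrDr ler_wpM2l ?sqrtr_ge0// ler_distD.
by rewrite normr_ge0 /= ![I (_ - _)]linearB ler_distD.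
Qed.

Context (M_ge0 : 0 <= M)
  (a_le : forall v1 v2, a v1 v2 <= `|v1| * `|v2|)
  (I_le : forall v, `|I v| <= M * `|v|)
  (Cs_le : forall q v, `|inner q (Cs v)| <= M * `|q| * `|v|).

Let alpha_sqrt : 0 < Num.sqrt alpha. Proof. by rewrite sqrtr_gt0. Qed.
Let s_gt0 : 0 < s. Proof. by rewrite invr_gt0. Qed.

Lemma lower_order_terms_le (v w phi : V1 * V2) :
  `|inner (proj v - proj w) (Cs phi.2) + s * inner (I (v - w).1) (I phi.1)|
  <= M / Num.sqrt alpha * delta Cs I alpha PK v w * prod_norm phi.
Proof.
apply: (@le_trans _ _ (M * `|proj v - proj w| * `|phi.2|
    + s * (`|I (v - w).1| * (M * `|phi.1|)))).
  rewrite (le_trans (ler_normD _ _))// lerD ?Cs_le//.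
  rewrite normrM [`|s|]gtr0_norm// ler_wpM2l ?(ltW s_gt0)//.
  rewrite (le_trans (inner_abs_le _ _))//.
  by rewrite ler_wpM2l.
(* The weight [Num.sqrt alpha] inside [delta] cancels against [M / Num.sqrt alpha], so both terms
   share one factor. *)
have := hypot_cauchy (Num.sqrt alpha * `|proj v - proj w|) `|I (v - w).1|
  `|phi.2| `|phi.1|.
rewrite -deltaE (hypotC `|phi.2|) -prod_normE.
have L0 : 0 <= M / Num.sqrt alpha by rewrite divr_ge0 ?sqrtr_ge0.
move=> /(ler_wpM2l L0); rewrite mulrA; apply: le_trans.
rewrite le_eqVlt; apply/predU1P; left; rewrite /s; field.
by rewrite gt_eqF.
Qed.

(** The two [a]-terms give the [prod_norm] part of the metric, the remaining terms its [delta]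
    part. *)
Lemma bform_continuous (v w phi : V1 * V2) :
  bform a Cs I alpha PK v phi - bform a Cs I alpha PK w phi
  <= dist_K Cs I alpha M PK v w * prod_norm phi.
Proof.
rewrite bformB /dist_K mulrDl -addrA -opprD lerD//; last first.
  rewrite (le_trans (ler_norm _))// normrN; exact: lower_order_terms_le.
apply: (le_trans (lerD (a_le _ _) (a_le _ _))).
rewrite (mulrC `|phi.1|) (le_trans (hypot_cauchy _ _ _ _))// prod_normE.
by rewrite (hypotC `|phi.2|).
Qed.

Context (CsB : forall v w, Cs (v - w) = Cs v - Cs w) (K : set Q)
  (K_convex : convex_set K) (PKP : is_metric_projection K PK).

(* The antisymmetric test function cancels the two [a]-terms. *)
Lemma bform_delta_le (v w : V1 * V2) :
  s * delta Cs I alpha PK v w ^+ 2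
  <= bform a Cs I alpha PK v (- (v - w).1, (v - w).2)
     - bform a Cs I alpha PK w (- (v - w).1, (v - w).2).
Proof.
rewrite bformB /= linearN linearNl linearNr /= subrr sub0r mulrN opprK.
rewrite inner_norm deltaE sqr_hypot mulrDr lerD2r exprMn.
have := metric_projection_firmly_nonexpansive (- s *: Cs v.2) (- s *: Cs w.2)
  K_convex PKP.
rewrite -scalerBr -CsB innerZr -/(proj v) -/(proj w) mulNr -mulrN => h.
(* Multiplying by [Num.sqrt alpha = 1 / s] frees the inner product; the factor left on the squared
   norm is [Num.sqrt alpha = s * alpha], the weight in [s * delta^2]. *)
have := ler_wpM2l (ltW alpha_sqrt) h.
rewrite (mulrA _ s) divff ?gt_eqF// mul1r.
apply: le_trans; rewrite mulrA sqr_sqrtr ?(ltW alpha_gt0)//.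
rewrite ler_wpM2r ?sqr_ge0// -[X in s * X](sqr_sqrtr (ltW alpha_gt0)) expr2.
by rewrite mulKf ?gt_eqF.
Qed.

End optimality_system.

(** * Quasi-optimality of the discrete solution *)

Theorem theorem5p3 (R : realType) (Q W V1 V2 : hilbertType R)
    (a : {bilinear V1 -> V2 -> R | *%R & *%R})
    (a_bounded : bounded_bilinear a)
    (a_inj : forall v1 : V1, (forall v2 : V2, a v1 v2 = 0) -> v1 = 0)
    (a_infsup : (0 < infsup a)%E)
    (norm2E : forall v2 : V2,
      `|v2| = sup [set a phi1 v2 | phi1 in unit_sphere V1])
    (C : {linear Q -> dual V2}) (C_bounded : bounded_op (@dual_norm R V2) C)
    (I : {linear V1 -> W}) (I_bounded : bounded_op Num.norm I)
    (Cs : V2 -> Q) (CsP : is_adjoint C Cs)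
    (alpha : R) (alpha_gt0 : 0 < alpha) (ud : W)
    (K : set Q) (K_neq0 : K !=set0) (K_closed : closed K)
    (K_convex : convex_set K)
    (PK : Q -> Q) (PKP : is_metric_projection K PK)
    (Vh1 : set V1) (Vh2 : set V2)
    (Vh1_fin : finite_dim_subspace Vh1) (Vh2_fin : finite_dim_subspace Vh2)
    (a_nondeg : nondegenerate_on a Vh1 Vh2)
    (Rh1 : V1 -> V1) (Rh1P : is_ritz_projection a Vh1 Vh2 Rh1)
    (mu : R) (muP : is_quasi_best_constant Vh1 Rh1 mu)
    (x : V1 * V2)
    (xP : forall phi : V1 * V2,
      bform a Cs I alpha PK x phi
      = - ((Num.sqrt alpha)^-1 * inner ud (I phi.1)))
    (xh : V1 * V2) (xh_in : (Vh1 `*` Vh2) xh)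
    (xhP : forall phih : V1 * V2, (Vh1 `*` Vh2) phih ->
      bform a Cs I alpha PK xh phih
      = - ((Num.sqrt alpha)^-1 * inner ud (I phih.1))) :
  let M := Num.max (opnorm Num.norm I) (opnorm (@dual_norm R V2) C) in
  let L := M / Num.sqrt alpha in
  let kappa := (1 + 2 * L) / (1 + L)
               * (1 + M * (1 + 2 * M / Num.sqrt alpha) * mu) in
  dist_K Cs I alpha M PK x xh
  <= (kappa * mu + 1)
     * inf [set dist_K Cs I alpha M PK x vh | vh in Vh1 `*` Vh2].
Proof.
lazy zeta; set M := Num.max _ _; set L := M / Num.sqrt alpha.
set kappa := (1 + 2 * L) / (1 + L) * _.
have I_ge0 : 0 <= opnorm Num.norm I by exact: opnorm_ge0.
have M0 : 0 <= M by rewrite le_max I_ge0.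
have a_le v1 v2 : a v1 v2 <= `|v1| * `|v2| by exact: bilinear_le_norm.
have I_le v : `|I v| <= M * `|v|.
  apply: le_trans (_ : opnorm Num.norm I * `|v| <= _).
    by apply: opnorm_le_mul => // c w; rewrite normrZ.
  by rewrite ler_wpM2r// le_max lexx.
have Cs_le q v : `|inner q (Cs v)| <= M * `|q| * `|v|.
  apply: le_trans (adjoint_le q v C_bounded CsP) _.
  by rewrite !ler_wpM2r// le_max lexx orbT.
have CsB v w : Cs (v - w) = Cs v - Cs w by exact: adjointB CsP.
have sa : 0 < Num.sqrt alpha by rewrite sqrtr_gt0.
have L0 : 0 <= L by rewrite divr_ge0// ltW.
have [mu_bound _] := muP; have [mu1 _] := mu_bound.
have mu0 : 0 < mu := lt_le_trans ltr01 mu1.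
have kappa0 : 0 <= kappa.
  have l0 : 0 <= 1 + 2 * L by rewrite addr_ge0// mulr_ge0.
  have l1 : 0 <= 1 + L by rewrite addr_ge0.
  have m0 : 0 <= M * (1 + 2 * L) * mu by rewrite !mulr_ge0// ltW.
  by rewrite /kappa -(mulrA 2) -/L mulr_ge0 ?divr_ge0// addr_ge0.
have const_gt0 : 0 < kappa * mu + 1.
  exact: ltr_wpDl (mulr_ge0 kappa0 (ltW mu0)) ltr01.
pose d := dist_K Cs I alpha M PK.
(* Dividing by the positive constant leaves a lower bound for an infimum, checked for each [vh];
   [xh] shows that the set is nonempty. *)
rewrite -ler_pdivrMl//; apply: lb_le_inf.
  by exists (d x xh); exists xh.
move=> _ [vh vh_in <-]; rewrite ler_pdivrMl//.
have d0 : 0 <= d x vh by exact: dist_K_ge0.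
pose y := L * delta Cs I alpha PK vh xh; pose N := prod_norm (vh - xh).
have y0 : 0 <= y by rewrite mulr_ge0// delta_ge0.
have N0 : 0 <= N by exact: hypot_ge0.
have uh_in : (Vh1 `*` Vh2) (vh - xh).
  case: vh_in => ? ?; case: xh_in => ? ?.
  by split; exact: finite_dim_subspaceB.
have residual phi : (Vh1 `*` Vh2) phi ->
    bform a Cs I alpha PK vh phi - bform a Cs I alpha PK xh phi
    <= d x vh * prod_norm phi.
  (* Galerkin orthogonality: on discrete [phi] the forms at [xh] and at [x] agree. *)
  move=> phi_in; rewrite xhP// -xP /d dist_KC//.
  exact: (bform_continuous PK alpha_gt0 M0 a_le I_le Cs_le).
(* Moving the terms without [a] to the right costs [y * prod_norm phi], hence stability with the
   constant [d x vh + y]. *)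
have N_le : N <= mu * (d x vh + y).
  apply: (discrete_stability norm2E Vh1_fin Vh2_fin a_nondeg Rh1P mu_bound
    uh_in).
    by rewrite addr_ge0.
  move=> phi phi_in; rewrite mulrDl.
  have := lower_order_terms_le PK alpha_gt0 M0 I_le Cs_le vh xh phi.
  move=> /(le_trans (ler_norm _)) h.
  have := residual phi phi_in; rewrite bformB -/L in h *; move: h.
  rewrite -/y; lra.
have y_le : y ^+ 2 <= M * L * d x vh * N.
  have h := le_trans (bform_delta_le a I alpha_gt0 CsB K_convex PKP vh xh)
    (residual (- (vh - xh).1, (vh - xh).2) _).
  have {}h : (Num.sqrt alpha)^-1 * delta Cs I alpha PK vh xh ^+ 2 <= d x vh * N.
    apply: le_trans (h _) _; last by rewrite prod_normE /= normrN.
    case: uh_in => u1 u2; split => //=.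
    by rewrite -scaleN1r; exact: finite_dim_subspaceZ.
  (* As [M / Num.sqrt alpha = L], the factor [M * L] turns the left side into
     [L^2 * delta^2 = y^2]. *)
  have := ler_wpM2l (mulr_ge0 M0 L0) h; rewrite !mulrA; apply: le_trans.
  by rewrite le_eqVlt; apply/predU1P; left; rewrite /y /L; ring.
have := kappa_bound M0 L0 d0 N0 y0 mu1 N_le y_le.
rewrite -/L -mulrA => comb.
have tri : d x xh <= d x vh + (N + y) by exact: dist_K_triangle.
apply: le_trans tri _; rewrite -/(d x vh) mulrDl mul1r addrC lerD2r.
by rewrite /kappa -(mulrA 2) -[leRHS]mulrA.
Qed.
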